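(* Let $m\ge 1$ be an integer, let $P_1(\theta)=A_1^1\cos\theta+B_1^1\sin\theta$ with real $A_1^1,B_1^1$ satisfying $(A_1^1)^2+(B_1^1)^2\ne 0$, let $\bar P_1(\theta)=A_1^1\sin\theta-B_1^1\cos\theta$, and let $P_{2m}(\theta)$ be a homogeneous polynomial of degree $2m$ with real coefficients in $\cos\theta$ and $\sin\theta$. Then $r=0$ is a center of the equation $$\frac{dr}{d\theta}=r\left(P_1(\theta)\,r+P_{2m}(\theta)\,r^{2m}\right)$$ if and only if $$\int_0^{2\pi}\bar P_1(\theta)^{2j}\,P_{2m}(\theta)\,d\theta=0\qquad (j=0,1,2,\dots,m).$$
   Context: For a scalar differential equation $\frac{dr}{d\theta}=F(\theta,r)$ with $F$ $2\pi$-periodic in $\theta$ and $F(\theta,0)\equiv 0$, we say that $r=0$ is a center if all solutions $r(\theta)$ close to the solution $r\equiv 0$ are $2\pi$-periodic, i.e. satisfy $r(2\pi)=r(0)$. *)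

(* Defs.v *)
From Stdlib Require Import Reals.
From Coquelicot Require Import Coquelicot.
Open Scope R_scope.

Definition P1 (A B : R) (theta : R) : R := A * cos theta + B * sin theta.

(* The primitive of [P1 A B] with zero mean over a period. *)
Definition P1bar (A B : R) (theta : R) : R := A * sin theta - B * cos theta.

Definition homogeneous_trig_poly (n : nat) (P : R -> R) : Prop :=
  exists c : nat -> R, forall theta : R,
    P theta = sum_f_R0 (fun k => c k * cos theta ^ k * sin theta ^ (n - k)) n.

(* Solutions are only required on one period, since a solution that is not
   2 PI-periodic may blow up later.  The derivative at the two endpoints is
   two-sided; this is no restriction, because a solution on the closed interval
   extends differentiably past its endpoints (e.g. affinely). *)
Definition solution_on_period (F : R -> R -> R) (r : R -> R) : Prop :=
  forall theta : R, 0 <= theta <= 2 * PI ->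
    is_derive r theta (F theta (r theta)).

(* Closeness to the zero solution is measured by the initial value, which may
   have either sign. *)
Definition center_at_zero (F : R -> R -> R) : Prop :=
  exists eps : R, 0 < eps /\
    forall r : R -> R, solution_on_period F r ->
      Rabs (r 0) < eps -> r (2 * PI) = r 0.

(* Main.v *)
(* If the moments vanish, write [P2m = e (P1bar) + P1 * q (P1bar)] with [e] and
   [q] polynomials of fixed parity: [e (P1bar)] is orthogonal to [P2m] and to
   [P1 * q (P1bar)], so it vanishes.  The equation is then reversible about each zero
   of [P1], and composing the reflections about two zeros at distance [PI]
   gives [r (2 * PI) = r 0].

   Conversely, along a positive solution [z = 1 / r + P1bar] satisfies
   [(z ^ (2 m))' = - 2 m P2m (1 - P1bar / z) ^ - (2 m - 1)], so for a center the
   integral of the right-hand side vanishes.  As [1 / z = x0 + O (x0 ^ (2 m + 1))],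
   expanding in [x0] gives [sum_(k <= 2 m) c_k I_k x0 ^ k = O (x0 ^ (2 m + 1))]
   with [c_k > 0] and [I_k] the [k]-th moment, hence every [I_k] is zero.  The
   small solutions to which this applies come from a Picard iteration. *)
Require Import Defs.
From Stdlib Require Import Reals Lra Lia Psatz.
From Coquelicot Require Import Coquelicot.
Open Scope R_scope.

(** * Lipschitz estimates for the field and a Gronwall inequality *)

Lemma pow_abs_le_1 (x : R) (n : nat) : Rabs x <= 1 -> Rabs (x ^ n) <= 1.
Proof.
  intros Hx. rewrite <- RPow_abs, <- (pow1 n).
  apply pow_incr. split; [apply Rabs_pos | assumption].
Qed.

Lemma pow_lipschitz (rho y y' : R) (n : nat) :
  Rabs y <= rho -> Rabs y' <= rho ->
  Rabs (y ^ S n - y' ^ S n) <= INR (S n) * rho ^ n * Rabs (y - y').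
Proof.
  intros Hy Hy'.
  assert (Hrho : 0 <= rho) by (apply Rle_trans with (2 := Hy); apply Rabs_pos).
  induction n as [|n IH].
  - simpl. rewrite !Rmult_1_r, Rmult_1_l. apply Rle_refl.
  - replace (y ^ S (S n) - y' ^ S (S n))
      with (y * (y ^ S n - y' ^ S n) + (y - y') * y' ^ S n) by (simpl; ring).
    eapply Rle_trans; [apply Rabs_triang|]. rewrite !Rabs_mult.
    replace (INR (S (S n)) * rho ^ S n * Rabs (y - y'))
      with (rho * (INR (S n) * rho ^ n * Rabs (y - y')) + Rabs (y - y') * rho ^ S n)
      by (rewrite (S_INR (S n)); simpl pow; ring).
    apply Rplus_le_compat.
    + apply Rmult_le_compat; auto using Rabs_pos.
    + apply Rmult_le_compat_l; [apply Rabs_pos|].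
      rewrite <- RPow_abs. apply pow_incr. split; [apply Rabs_pos | assumption].
Qed.

Lemma field_lipschitz (W rho p q y y' : R) (n : nat) :
  Rabs p <= W -> Rabs q <= W -> Rabs y <= rho -> Rabs y' <= rho ->
  Rabs (y * (p * y + q * y ^ n) - y' * (p * y' + q * y' ^ n))
    <= W * (2 * rho + INR (S n) * rho ^ n) * Rabs (y - y').
Proof.
  intros Hp Hq Hy Hy'.
  replace (y * (p * y + q * y ^ n) - y' * (p * y' + q * y' ^ n))
    with (p * (y ^ 2 - y' ^ 2) + q * (y ^ S n - y' ^ S n)) by (simpl; ring).
  eapply Rle_trans; [apply Rabs_triang|]. rewrite !Rabs_mult.
  assert (H1 := pow_lipschitz rho y y' 1 Hy Hy').
  assert (H2 := pow_lipschitz rho y y' n Hy Hy').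
  replace (INR 2 * rho ^ 1) with (2 * rho) in H1 by (simpl; ring).
  rewrite Rmult_assoc, Rmult_plus_distr_r, Rmult_plus_distr_l.
  apply Rplus_le_compat; apply Rmult_le_compat; auto using Rabs_pos.
Qed.

(** The square of [d] damped by [exp (- (2 * M * s))] has nonpositive derivative and starts at 0, so
    one application of the mean value theorem makes it nonpositive at [l]. Squaring avoids
    differentiating an absolute value. *)
Lemma gronwall_zero (d d' : R -> R) (M l : R) :
  0 <= l -> d 0 = 0 ->
  (forall s, 0 <= s <= l -> is_derive d s (d' s) /\ Rabs (d' s) <= M * Rabs (d s)) ->
  d l = 0.
Proof.
  intros Hl H0 Hd.
  set (g := fun s => d s ^ 2 * exp (- (2 * M * s))).
  assert (Hg : forall s, 0 <= s <= l ->
    is_derive g s ((2 * (d s * d' s) - 2 * M * d s ^ 2) * exp (- (2 * M * s)))).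
  { intros s Hs. destruct (Hd s Hs) as [H1 _]. unfold g.
    auto_derive.
    - exists (d' s); exact H1.
    - replace (Derive (fun x : R => d x) s) with (d' s)
        by (symmetry; apply is_derive_unique; exact H1).
      ring. }
  destruct (MVT_gen g 0 l (fun s => (2 * (d s * d' s) - 2 * M * d s ^ 2) * exp (- (2 * M * s))))
    as [c [Hc Heq]].
  - intros s Hs. apply Hg. rewrite Rmin_left, Rmax_right in Hs by lra. lra.
  - intros s Hs. rewrite Rmin_left, Rmax_right in Hs by lra.
    apply continuity_pt_filterlim, (ex_derive_continuous (K := R_AbsRing) (V := R_NormedModule)).
    eexists; apply Hg; lra.
  - rewrite Rmin_left, Rmax_right in Hc by lra.
    assert (Hle : d c * d' c <= M * d c ^ 2).
    { eapply Rle_trans; [apply Rle_abs|]. rewrite Rabs_mult.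
      destruct (Hd c Hc) as [_ H1]. rewrite <- (pow2_abs (d c)).
      replace (M * Rabs (d c) ^ 2) with (Rabs (d c) * (M * Rabs (d c))) by ring.
      apply Rmult_le_compat_l; [apply Rabs_pos | assumption]. }
    assert (Hgl : g l <= 0).
    { unfold g in Heq at 2. rewrite H0 in Heq.
      assert (He := exp_pos (- (2 * M * c))).
      assert (0 <= (M * d c ^ 2 - d c * d' c) * exp (- (2 * M * c)) * l)
        by (repeat apply Rmult_le_pos; lra).
      lra. }
    unfold g in Hgl. assert (He := exp_pos (- (2 * M * l))).
    assert (Hsq := pow2_ge_0 (d l)). apply Rsqr_0_uniq. unfold Rsqr. nra.
Qed.

(** * Existence of small solutions by Picard iteration *)

(** The tail of a geometric series bounds all later differences: this makes the sequence Cauchy, and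
    passing to the limit in the same bound gives the rate. *)
Lemma geometric_lim (a : nat -> R) (K : R) :
  (forall n, Rabs (a (S n) - a n) <= K * (1 / 2) ^ n) ->
  forall n, Rabs (real (Lim_seq a) - a n) <= 2 * K * (1 / 2) ^ n.
Proof.
  intros Ha.
  assert (HK : 0 <= K).
  { specialize (Ha O). simpl in Ha. assert (H := Rabs_pos (a 1%nat - a O)). lra. }
  assert (Hpow : forall n, 0 < (1 / 2) ^ n) by (intros; apply pow_lt; lra).
  (* Keeping the subtracted term [(1 / 2) ^ (n + p)] is what lets the induction on [p] close. *)
  assert (Hd : forall n p, Rabs (a (n + p)%nat - a n)
                 <= 2 * K * ((1 / 2) ^ n - (1 / 2) ^ (n + p))).
  { intros n p. induction p as [|p IH].
    - rewrite Nat.add_0_r, !Rminus_diag, Rabs_R0. lra.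
    - rewrite Nat.add_succ_r.
      replace (a (S (n + p)) - a n)
        with ((a (S (n + p)) - a (n + p)%nat) + (a (n + p)%nat - a n)) by ring.
      eapply Rle_trans; [apply Rabs_triang|].
      specialize (Ha (n + p)%nat). simpl pow. lra. }
  assert (Hd' : forall n p, Rabs (a (n + p)%nat - a n) <= 2 * K * (1 / 2) ^ n).
  { intros n p. eapply Rle_trans; [apply Hd|].
    apply Rmult_le_compat_l; [lra|]. specialize (Hpow (n + p)%nat). lra. }
  assert (Hex : ex_finite_lim_seq a).
  { apply ex_lim_seq_cauchy_corr. intros eps.
    assert (Hlim : is_lim_seq (fun n => 4 * K * (1 / 2) ^ n) 0).
    { replace (Finite 0) with (Rbar_mult (4 * K) 0) by (simpl; f_equal; ring).
      apply is_lim_seq_scal_l, is_lim_seq_geom. rewrite Rabs_pos_eq; lra. }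
    apply is_lim_seq_spec in Hlim. destruct (Hlim eps) as [N HN].
    exists N. intros p q Hp Hq.
    specialize (HN N (le_n N)). rewrite Rminus_0_r in HN.
    assert (H1 := Hd' N (p - N)%nat). assert (H2 := Hd' N (q - N)%nat).
    replace (N + (p - N))%nat with p in H1 by lia.
    replace (N + (q - N))%nat with q in H2 by lia.
    apply Rabs_def2 in HN.
    replace (a p - a q) with ((a p - a N) - (a q - a N)) by ring.
    eapply Rle_lt_trans; [apply Rabs_triang|]. rewrite Rabs_Ropp. lra. }
  intros n. apply Lim_seq_correct' in Hex.
  assert (Hs : is_lim_seq (fun p => Rabs (a (n + p)%nat - a n))
                 (Rabs (real (Lim_seq a) - a n))).
  { apply (is_lim_seq_abs _ (real (Lim_seq a) - a n)).
    apply is_lim_seq_minus'; [|apply is_lim_seq_const].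
    apply (is_lim_seq_ext (fun p => a (p + n)%nat)).
    - intros p. now rewrite Nat.add_comm.
    - now apply is_lim_seq_incr_n. }
  exact (is_lim_seq_le _ _ _ (Finite (2 * K * (1 / 2) ^ n)) (Hd' n) Hs
           (is_lim_seq_const _)).
Qed.

Lemma abs_RInt_0_le (f : R -> R) (c M : R) :
  (forall t, continuous f t) -> (forall t, Rabs t <= Rabs c -> Rabs (f t) <= M) ->
  Rabs (RInt f 0 c) <= Rabs c * M.
Proof.
  intros Hf HM. destruct (Rle_dec 0 c) as [Hc|Hc].
  - rewrite (Rabs_pos_eq c Hc) in *.
    replace (c * M) with ((c - 0) * M) by ring.
    apply abs_RInt_le_const; [lra | now apply (ex_RInt_continuous (V := R_CompleteNormedModule))|].
    intros t Ht. apply HM. rewrite Rabs_pos_eq; lra.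
  - rewrite (Rabs_left c) in * by lra.
    rewrite <- opp_RInt_swap by now apply (ex_RInt_continuous (V := R_CompleteNormedModule)).
    unfold opp; simpl. rewrite Rabs_Ropp.
    replace (- c * M) with ((0 - c) * M) by ring.
    apply abs_RInt_le_const; [lra | now apply (ex_RInt_continuous (V := R_CompleteNormedModule))|].
    intros t Ht. apply HM. rewrite Rabs_left1; lra.
Qed.

Definition clamp (T t : R) : R := Rmax (- T) (Rmin T t).

Lemma clamp_bound (T t : R) : 0 <= T -> Rabs (clamp T t) <= T.
Proof.
  intros HT. apply Rabs_le. unfold clamp, Rmax, Rmin.
  repeat destruct Rle_dec; lra.
Qed.

Lemma clamp_id (T t : R) : Rabs t <= T -> clamp T t = t.
Proof.
  intros Ht. apply Rabs_le_between in Ht. unfold clamp, Rmax, Rmin.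
  repeat destruct Rle_dec; lra.
Qed.

Lemma clamp_continuous (T t : R) : 0 <= T -> continuous (clamp T) t.
Proof.
  intros HT. apply continuity_pt_filterlim. intros eps Heps. exists eps.
  split; [assumption|]. intros x [_ Hx]. simpl in *. unfold R_dist in *.
  eapply Rle_lt_trans with (2 := Hx). unfold clamp, Rmax, Rmin, Rabs.
  repeat destruct Rle_dec; repeat destruct Rcase_abs; lra.
Qed.

Lemma uniform_limit_continuous (u : nat -> R -> R) (v : R -> R) (K : R) :
  (forall n t, continuous (u n) t) ->
  (forall n t, Rabs (v t - u n t) <= K * (1 / 2) ^ n) ->
  forall t, continuous v t.
Proof.
  intros Hu Hv t. apply continuity_pt_filterlim.
  apply (CVU_continuity u v t (mkposreal 1 Rlt_0_1)).
  - intros eps Heps.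
    assert (Hlim : is_lim_seq (fun n => K * (1 / 2) ^ n) 0).
    { replace (Finite 0) with (Rbar_mult K 0) by (simpl; f_equal; ring).
      apply is_lim_seq_scal_l, is_lim_seq_geom. rewrite Rabs_pos_eq; lra. }
    apply is_lim_seq_spec in Hlim. destruct (Hlim (mkposreal eps Heps)) as [N HN].
    exists N. intros n y Hn _. eapply Rle_lt_trans; [apply Hv|].
    specialize (HN n Hn). simpl in HN. rewrite Rminus_0_r in HN.
    eapply Rle_lt_trans; [apply Rle_abs | exact HN].
  - intros n y _. apply continuity_pt_filterlim, Hu.
  - unfold Boule. simpl. rewrite Rminus_diag, Rabs_R0. lra.
Qed.

Lemma RInt_0_is_derive (f : R -> R) (t : R) :
  (forall s, continuous f s) -> is_derive (fun x => RInt f 0 x) t (f t).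
Proof.
  intros Hf. apply (is_derive_RInt f _ 0); [|apply Hf].
  exists (mkposreal 1 Rlt_0_1). intros x _.
  now apply (RInt_correct (V := R_CompleteNormedModule)), (ex_RInt_continuous (V := R_CompleteNormedModule)).
Qed.

(* Clamping the time variable makes every estimate on [- T, T] a global one. *)
Fixpoint picard (F : R -> R -> R) (T r0 : R) (n : nat) : R -> R :=
  match n with
  | O => fun _ => r0
  | S n' => fun t => r0 + RInt (fun s => F s (picard F T r0 n' s)) 0 (clamp T t)
  end.

(* The field is [L]-Lipschitz with [T * L <= 1 / 4], so Picard's operator is a
   contraction in the uniform norm on [- T, T] and no weighted norm is needed. *)
Lemma small_solution_exists (F : R -> R -> R) (T L r0 : R) :
  0 <= T -> 0 <= L -> T * L <= 1 / 4 ->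
  (forall u : R -> R, (forall t, continuous u t) ->
     forall t, continuous (fun s => F s (u s)) t) ->
  (forall s, F s 0 = 0) ->
  (forall s y y', Rabs s <= T -> Rabs y <= 2 * Rabs r0 -> Rabs y' <= 2 * Rabs r0 ->
     Rabs (F s y - F s y') <= L * Rabs (y - y')) ->
  exists r : R -> R, r 0 = r0 /\
    forall t, Rabs t < T -> is_derive r t (F t (r t)) /\ Rabs (r t - r0) <= Rabs r0 / 2.
Proof.
  intros HT HL HTL HFc HF0 HFL.
  set (u := picard F T r0). set (q := Rabs r0) in *.
  assert (Hq : 0 <= q) by apply Rabs_pos.
  (* Since the field vanishes at [y = 0], its Lipschitz bound also bounds its size. *)
  assert (HFb : forall s y, Rabs s <= T -> Rabs y <= 2 * q -> Rabs (F s y) <= L * (2 * q)).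
  { intros s y Hs Hy. replace (F s y) with (F s y - F s 0) by (rewrite HF0; ring).
    eapply Rle_trans; [apply HFL; auto; rewrite Rabs_R0; lra|].
    rewrite Rminus_0_r. now apply Rmult_le_compat_l. }
  (* The integration stays inside [[- T, T]] over a length of at most [T], so [T * L <= 1 / 4] turns
     the bound [L * M] on the integrand into [M / 4]. *)
  assert (Hint : forall (g : R -> R) M t, (forall s, continuous g s) ->
            0 <= M -> (forall s, Rabs s <= T -> Rabs (g s) <= L * M) ->
            Rabs (RInt g 0 (clamp T t)) <= M / 4).
  { intros g M t Hg HM Hb.
    assert (Hc := clamp_bound T t HT).
    eapply Rle_trans; [apply (abs_RInt_0_le g _ (L * M)); auto|].
    - intros s Hs. apply Hb. lra.
    - replace (M / 4) with (1 / 4 * M) by lra.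
      apply Rle_trans with (T * L * M); [rewrite Rmult_assoc|now apply Rmult_le_compat_r].
      apply Rmult_le_compat_r; [now apply Rmult_le_pos|assumption]. }
  assert (Hstep : forall w : R -> R, (forall t, continuous w t) ->
            forall t, continuous (fun x => r0 + RInt (fun s => F s (w s)) 0 (clamp T x)) t).
  { intros w Hw t. apply (continuous_plus (V := R_NormedModule)); [apply continuous_const|].
    apply (continuous_comp (clamp T) (fun x => RInt (fun s => F s (w s)) 0 x)).
    - now apply clamp_continuous.
    - apply (ex_derive_continuous (K := R_AbsRing) (V := R_NormedModule)).
      eexists. apply RInt_0_is_derive. now apply HFc. }
  assert (Huc : forall n t, continuous (u n) t).
  { induction n as [|n IH]; [intros; apply continuous_const|]. exact (Hstep (u n) IH). }
  assert (Hclose : forall w : R -> R, (forall t, continuous w t) ->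
            (forall t, Rabs (w t) <= 2 * q) -> forall t,
            Rabs (RInt (fun s => F s (w s)) 0 (clamp T t)) <= q / 2).
  { intros w Hw Hb t. replace (q / 2) with (2 * q / 4) by lra.
    apply Hint; [now apply HFc | lra | auto]. }
  (* Each iterate stays within [q / 2] of [r0], hence in the ball of radius [2 * q] where the
     Lipschitz bound is available. *)
  assert (Hub : forall n t, Rabs (u n t) <= 2 * q).
  { induction n as [|n IH]; intros t; [unfold u, picard; fold q; lra|].
    change (Rabs (r0 + RInt (fun s => F s (u n s)) 0 (clamp T t)) <= 2 * q).
    eapply Rle_trans; [apply Rabs_triang|]. fold q.
    assert (H := Hclose (u n) (Huc n) IH t). lra. }
  assert (Hcontr : forall (w w' : R -> R) M, (forall t, continuous w t) ->
            (forall t, continuous w' t) ->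
            (forall t, Rabs (w t) <= 2 * q) -> (forall t, Rabs (w' t) <= 2 * q) ->
            0 <= M -> (forall t, Rabs (w t - w' t) <= M) ->
            forall t, Rabs (RInt (fun s => F s (w s)) 0 (clamp T t)
                            - RInt (fun s => F s (w' s)) 0 (clamp T t)) <= M / 4).
  { intros w w' M Hw Hw' Hb Hb' HM Hww t.
    change (Rabs (minus (RInt (fun s => F s (w s)) 0 (clamp T t))
                        (RInt (fun s => F s (w' s)) 0 (clamp T t))) <= M / 4).
    rewrite <- (RInt_minus (V := R_CompleteNormedModule)) by
      (apply (ex_RInt_continuous (V := R_CompleteNormedModule)); intros; now apply HFc).
    apply Hint; auto.
    - intros s. apply (continuous_minus (V := R_NormedModule)); now apply HFc.
    - intros s Hs. eapply Rle_trans; [apply HFL; auto|]. now apply Rmult_le_compat_l. }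
  assert (Hpow : forall n, 0 < (1 / 2) ^ n) by (intros; apply pow_lt; lra).
  assert (Hdiff : forall n t, Rabs (u (S n) t - u n t) <= q * (1 / 2) ^ n).
  { induction n as [|n IH]; intros t.
    - change (Rabs (r0 + RInt (fun s => F s (u O s)) 0 (clamp T t) - r0) <= q * 1).
      rewrite Rplus_minus_l.
      eapply Rle_trans; [apply Hclose; auto|]. lra.
    - change (Rabs (r0 + RInt (fun s => F s (u (S n) s)) 0 (clamp T t)
                    - (r0 + RInt (fun s => F s (u n s)) 0 (clamp T t)))
              <= q * (1 / 2) ^ S n).
      rewrite Rminus_plus_l_l.
      specialize (Hpow n).
      eapply Rle_trans;
        [apply (Hcontr (u (S n)) (u n) (q * (1 / 2) ^ n)); auto; nra|].
      simpl pow. nra. }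
  (* [Lim_seq] is total; [Hdiff] and [geometric_lim] make it a genuine limit here. *)
  set (v := fun t => real (Lim_seq (fun n => u n t))).
  assert (Hv : forall n t, Rabs (v t - u n t) <= 2 * q * (1 / 2) ^ n).
  { intros n t. exact (geometric_lim (fun n => u n t) q (fun n => Hdiff n t) n). }
  assert (Hvc : forall t, continuous v t) by exact (uniform_limit_continuous u v _ Huc Hv).
  assert (Hzero : forall K x, (forall n, Rabs x <= K * (1 / 2) ^ n) -> x = 0).
  { intros K x Hx. apply Rabs_eq_0. apply Rle_antisym; [|apply Rabs_pos].
    assert (Hlim : is_lim_seq (fun n => K * (1 / 2) ^ n) (Rbar_mult K 0)).
    { apply is_lim_seq_scal_l, is_lim_seq_geom. rewrite Rabs_pos_eq; lra. }
    assert (H := is_lim_seq_le _ _ (Finite (Rabs x)) _ Hx (is_lim_seq_const _) Hlim).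
    simpl in H. lra. }
  assert (Hvb : forall t, Rabs (v t) <= 2 * q).
  { intros t.
    assert (Hs : is_lim_seq (fun n => 2 * q + 2 * q * (1 / 2) ^ n) (2 * q)).
    { replace (Finite (2 * q)) with (Finite (2 * q + 2 * q * 0)) by (f_equal; ring).
      apply is_lim_seq_plus'; [apply is_lim_seq_const|].
      apply (is_lim_seq_scal_l _ (2 * q) 0), is_lim_seq_geom. rewrite Rabs_pos_eq; lra. }
    refine (is_lim_seq_le _ _ (Finite (Rabs (v t))) _ _ (is_lim_seq_const _) Hs).
    intros n. replace (v t) with (u n t + (v t - u n t)) by ring.
    eapply Rle_trans; [apply Rabs_triang|]. apply Rplus_le_compat; auto. }
  (* The residual of the fixed point equation splits into the distance from [v] to the next iterate
     and a difference of Picard integrals; both are [O ((1 / 2) ^ n)] for every [n]. *)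
  assert (Hfix : forall t, v t = r0 + RInt (fun s => F s (v s)) 0 (clamp T t)).
  { intros t. apply Rminus_diag_uniq. apply (Hzero (2 * q)). intros n.
    assert (Hu : u (S n) t = r0 + RInt (fun s => F s (u n s)) 0 (clamp T t))
      by reflexivity.
    replace (v t - (r0 + RInt (fun s => F s (v s)) 0 (clamp T t)))
      with ((v t - u (S n) t)
            - (RInt (fun s => F s (v s)) 0 (clamp T t)
               - RInt (fun s => F s (u n s)) 0 (clamp T t)))
      by (rewrite Hu; ring).
    eapply Rle_trans; [apply Rabs_triang|]. rewrite Rabs_Ropp.
    assert (H1 := Hv (S n) t). simpl pow in H1. specialize (Hpow n).
    assert (H2 : 0 <= 2 * q * (1 / 2) ^ n) by nra.
    assert (H3 := Hcontr v (u n) _ Hvc (Huc n) Hvb (Hub n) H2 (Hv n) t).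
    lra. }
  exists v. split.
  - rewrite Hfix, clamp_id by (rewrite Rabs_R0; assumption).
    rewrite (RInt_point (V := R_CompleteNormedModule)). unfold zero; simpl. ring.
  - intros t Ht. split.
    (* Near an interior point the clamp is the identity, so [v] is locally an integral with moving
       endpoint and has a two-sided derivative. *)
    + apply (is_derive_ext_loc (fun x => r0 + RInt (fun s => F s (v s)) 0 x)).
      * assert (Hpos : 0 < T - Rabs t) by lra.
        exists (mkposreal _ Hpos). intros x Hx.
        assert (Hx' : Rabs (x - t) < T - Rabs t) by exact Hx.
        rewrite Hfix, clamp_id; [reflexivity|].
        replace x with ((x - t) + t) by ring.
        eapply Rle_trans; [apply Rabs_triang|]. lra.
      * replace (F t (v t)) with (plus 0 (F t (v t))) by (unfold plus; simpl; ring).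
        apply (is_derive_plus (K := R_AbsRing) (V := R_NormedModule));
          [apply (is_derive_const (K := R_AbsRing) (V := R_NormedModule) r0)|].
        apply (RInt_0_is_derive (fun s => F s (v s))). now apply HFc.
    + rewrite Hfix, Rplus_minus_l. now apply Hclose.
Qed.

(** * The forms [P1] and [P1bar], and polynomials of fixed parity *)

Lemma P1_continuous (A B t : R) : continuous (P1 A B) t.
Proof.
  apply (ex_derive_continuous (K := R_AbsRing) (V := R_NormedModule)).
  unfold P1. auto_derive. exact I.
Qed.

Lemma P1bar_is_derive (A B t : R) : is_derive (P1bar A B) t (P1 A B t).
Proof. unfold P1bar, P1. auto_derive; [exact I | ring]. Qed.

Lemma P1bar_continuous (A B t : R) : continuous (P1bar A B) t.
Proof.
  apply (ex_derive_continuous (K := R_AbsRing) (V := R_NormedModule)).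
  eexists. apply P1bar_is_derive.
Qed.

Lemma P1_sqr_plus_P1bar_sqr (A B t : R) :
  P1 A B t ^ 2 + P1bar A B t ^ 2 = A ^ 2 + B ^ 2.
Proof.
  assert (H := sin2_cos2 t). unfold Rsqr in H. unfold P1, P1bar.
  replace (A ^ 2 + B ^ 2) with ((A ^ 2 + B ^ 2) * (sin t * sin t + cos t * cos t))
    by (rewrite H; ring).
  ring.
Qed.

Lemma P1bar_2PI (A B : R) : P1bar A B (2 * PI) = P1bar A B 0.
Proof. unfold P1bar. rewrite sin_2PI, cos_2PI, sin_0, cos_0. reflexivity. Qed.

(** Around a zero [tau] of [P1], the function [P1] is a multiple of [sin s] and [P1bar] one of
    [cos s]. Both defects from the symmetry are multiples of [P1 A B tau]. *)
Lemma P1_reflect (A B tau s : R) : P1 A B tau = 0 ->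
  P1 A B (tau - s) = - P1 A B (tau + s) /\ P1bar A B (tau - s) = P1bar A B (tau + s).
Proof.
  unfold P1, P1bar. intros H0.
  rewrite !cos_minus, !sin_minus, !cos_plus, !sin_plus.
  split; apply Rminus_diag_uniq.
  - transitivity (2 * cos s * (A * cos tau + B * sin tau)); [ring | rewrite H0; ring].
  - transitivity (- 2 * sin s * (A * cos tau + B * sin tau)); [ring | rewrite H0; ring].
Qed.

(* [parity_poly d f]: [f] is a polynomial function of degree at most [d - 1]
   and of the parity of [d - 1] (the zero function when [d = 0]). *)
Inductive parity_poly : nat -> (R -> R) -> Prop :=
| parity_poly_zero : parity_poly 0 (fun _ => 0)
| parity_poly_const a : parity_poly 1 (fun _ => a)
| parity_poly_mul d f : parity_poly d f -> parity_poly (S d) (fun c => c * f c)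
| parity_poly_up d f : parity_poly d f -> parity_poly (S (S d)) f
| parity_poly_plus d f g :
    parity_poly d f -> parity_poly d g -> parity_poly d (fun c => f c + g c)
| parity_poly_scal d a f : parity_poly d f -> parity_poly d (fun c => a * f c).

Lemma parity_poly_continuous (d : nat) (f : R -> R) :
  parity_poly d f -> forall c, continuous f c.
Proof.
  induction 1; intros c.
  - apply continuous_const.
  - apply continuous_const.
  - apply (continuous_mult (K := R_AbsRing)); [apply continuous_id | auto].
  - auto.
  - apply (continuous_plus (V := R_NormedModule)); auto.
  - apply (continuous_mult (K := R_AbsRing)); [apply continuous_const | auto].
Qed.

Lemma continuous_pow (f : R -> R) (n : nat) (t : R) :
  continuous f t -> continuous (fun s => f s ^ n) t.
Proof.
  intros Hf. induction n as [|n IH]; simpl.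
  - apply continuous_const.
  - now apply (continuous_mult (K := R_AbsRing)).
Qed.

(** The monomial factor [x t ^ i] is there for the induction: multiplying the polynomial by its
    variable raises [i] and lowers [d], leaving [i + d] fixed. The equation [i + d = j + 2 * k + 1]
    lists exactly the powers [j] that can occur, by degree and parity. *)
Lemma parity_poly_orthogonal (w x : R -> R) (a b : R) (d : nat) (f : R -> R) :
  (forall t, continuous w t) -> (forall t, continuous x t) ->
  parity_poly d f ->
  forall i : nat,
    (forall j k : nat, (i + d = j + 2 * k + 1)%nat ->
       RInt (fun t => w t * x t ^ j) a b = 0) ->
    RInt (fun t => w t * x t ^ i * f (x t)) a b = 0.
Proof.
  intros Hw Hx Hf.
  assert (Hint : forall i g, (forall c, continuous g c) ->
            ex_RInt (fun t => w t * x t ^ i * g (x t)) a b).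
  { intros i g Hg. apply (ex_RInt_continuous (V := R_CompleteNormedModule)). intros t _.
    apply (continuous_mult (K := R_AbsRing)); [apply (continuous_mult (K := R_AbsRing))|].
    - apply Hw.
    - now apply continuous_pow.
    - now apply continuous_comp. }
  induction Hf as [|c|d f Hf IH|d f Hf IH|d f g Hf IHf Hg IHg|d c f Hf IH]; intros i Hm.
  - rewrite (RInt_ext _ (fun _ => 0)) by (intros; simpl; ring).
    rewrite RInt_const. apply Rmult_0_r.
  - rewrite (RInt_ext _ (fun t => scal c (w t * x t ^ i)))
      by (intros; unfold scal; simpl; unfold mult; simpl; ring).
    rewrite (RInt_scal (V := R_CompleteNormedModule)).
    + rewrite (Hm i O) by lia. apply Rmult_0_r.
    + apply (ex_RInt_ext (fun t => w t * x t ^ i * 1)); [intros; simpl; ring|].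
      apply (Hint i (fun _ => 1)). intros. apply continuous_const.
  - rewrite (RInt_ext _ (fun t => w t * x t ^ S i * f (x t))) by (intros; simpl; ring).
    apply IH. intros j k Hjk. apply (Hm j k). lia.
  - apply IH. intros j k Hjk. apply (Hm j (S k)). lia.
  - rewrite (RInt_ext _ (fun t => plus (w t * x t ^ i * f (x t)) (w t * x t ^ i * g (x t))))
      by (intros; unfold plus; simpl; ring).
    rewrite (RInt_plus (V := R_CompleteNormedModule))
      by (apply Hint; eapply parity_poly_continuous; eassumption).
    rewrite IHf, IHg by assumption. apply Rplus_0_r.
  - rewrite (RInt_ext _ (fun t => scal c (w t * x t ^ i * f (x t))))
      by (intros; unfold scal; simpl; unfold mult; simpl; ring).
    rewrite (RInt_scal (V := R_CompleteNormedModule))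
      by (apply Hint; eapply parity_poly_continuous; eassumption).
    rewrite IH by assumption. apply Rmult_0_r.
Qed.

(** * Splitting trigonometric forms into even and odd parts *)

(** Even and odd refer to the reflection about a zero of [P1], which preserves [P1bar] and negates
    [P1]. The index of [parity_poly] exceeds the degree bound by one, so [e] has degree at most [n]
    and [q] at most [n - 1]. *)
Definition even_odd_split (A B : R) (n : nat) (f e q : R -> R) : Prop :=
  parity_poly (S n) e /\ parity_poly n q /\
  forall t, f t = e (P1bar A B t) + P1 A B t * q (P1bar A B t).

Definition splits (A B : R) (n : nat) (f : R -> R) : Prop :=
  exists e q, even_odd_split A B n f e q.

Lemma splits_ext (A B : R) (n : nat) (f g : R -> R) :
  (forall t, f t = g t) -> splits A B n f -> splits A B n g.
Proof.
  intros Hfg [e [q [He [Hq H]]]]. exists e, q. repeat split; auto.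
  intros t. rewrite <- Hfg. apply H.
Qed.

Lemma splits_plus (A B : R) (n : nat) (f g : R -> R) :
  splits A B n f -> splits A B n g -> splits A B n (fun t => f t + g t).
Proof.
  intros [e [q [He [Hq H]]]] [e' [q' [He' [Hq' H']]]].
  exists (fun c => e c + e' c), (fun c => q c + q' c).
  repeat split; try now constructor.
  intros t. rewrite H, H'. ring.
Qed.

Lemma splits_scal (A B a : R) (n : nat) (f : R -> R) :
  splits A B n f -> splits A B n (fun t => a * f t).
Proof.
  intros [e [q [He [Hq H]]]].
  exists (fun c => a * e c), (fun c => a * q c).
  repeat split; try now constructor.
  intros t. rewrite H. ring.
Qed.

Lemma splits_P1bar (A B : R) (n : nat) (f : R -> R) :
  splits A B n f -> splits A B (S n) (fun t => P1bar A B t * f t).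
Proof.
  intros [e [q [He [Hq H]]]].
  exists (fun c => c * e c), (fun c => c * q c).
  repeat split; try now constructor.
  intros t. rewrite H. ring.
Qed.

(** Multiplication by [P1] exchanges the two parts: [e] becomes the odd coefficient, while
    [P1 ^ 2 * q] is rewritten through [P1 ^ 2 = A ^ 2 + B ^ 2 - P1bar ^ 2] as a polynomial in
    [P1bar] of the right parity. *)
Lemma splits_P1 (A B : R) (n : nat) (f : R -> R) :
  splits A B n f -> splits A B (S n) (fun t => P1 A B t * f t).
Proof.
  intros [e [q [He [Hq H]]]].
  exists (fun c => (A ^ 2 + B ^ 2) * q c + (-1) * (c * (c * q c))), e.
  repeat split; try assumption.
  - apply parity_poly_plus; apply parity_poly_scal; now repeat constructor.
  - intros t. rewrite H, <- (P1_sqr_plus_P1bar_sqr A B t). ring.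
Qed.

(** The pair ([P1], [P1bar]) is ([cos], [sin]) rotated and scaled; inverting this map writes [cos]
    as a combination of [P1] and [P1bar]. *)
Lemma splits_cos (A B : R) (n : nat) (f : R -> R) : A ^ 2 + B ^ 2 <> 0 ->
  splits A B n f -> splits A B (S n) (fun t => cos t * f t).
Proof.
  intros HAB Hf.
  apply (splits_ext _ _ _ (fun t => A / (A ^ 2 + B ^ 2) * (P1 A B t * f t)
                             + (- B / (A ^ 2 + B ^ 2)) * (P1bar A B t * f t))).
  - intros t. unfold P1, P1bar. now field.
  - apply splits_plus; apply splits_scal; [now apply splits_P1 | now apply splits_P1bar].
Qed.

Lemma splits_sin (A B : R) (n : nat) (f : R -> R) : A ^ 2 + B ^ 2 <> 0 ->
  splits A B n f -> splits A B (S n) (fun t => sin t * f t).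
Proof.
  intros HAB Hf.
  apply (splits_ext _ _ _ (fun t => B / (A ^ 2 + B ^ 2) * (P1 A B t * f t)
                             + A / (A ^ 2 + B ^ 2) * (P1bar A B t * f t))).
  - intros t. unfold P1, P1bar. now field.
  - apply splits_plus; apply splits_scal; [now apply splits_P1 | now apply splits_P1bar].
Qed.

Lemma splits_monomial (A B : R) (k l : nat) : A ^ 2 + B ^ 2 <> 0 ->
  splits A B (k + l) (fun t => cos t ^ k * sin t ^ l).
Proof.
  intros HAB. induction k as [|k IH]; simpl.
  - induction l as [|l IH]; simpl.
    + exists (fun _ => 1), (fun _ => 0). repeat split; [constructor|constructor|].
      intros t. ring.
    + apply (splits_ext _ _ _ (fun t => sin t * (1 * sin t ^ l))); [intros; ring|].
      now apply splits_sin.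
  - apply (splits_ext _ _ _ (fun t => cos t * (cos t ^ k * sin t ^ l))); [intros; ring|].
    now apply splits_cos.
Qed.

Lemma homogeneous_splits (A B : R) (n : nat) (P : R -> R) : A ^ 2 + B ^ 2 <> 0 ->
  homogeneous_trig_poly n P -> splits A B n P.
Proof.
  intros HAB [c Hc].
  apply (splits_ext _ _ _ (fun t => sum_f_R0 (fun k => c k * cos t ^ k * sin t ^ (n - k)) n));
    [intros; now rewrite Hc|].
  assert (Hterm : forall k, (k <= n)%nat ->
            splits A B n (fun t => c k * cos t ^ k * sin t ^ (n - k))).
  { intros k Hk.
    apply (splits_ext _ _ _ (fun t => c k * (cos t ^ k * sin t ^ (n - k)))); [intros; ring|].
    apply splits_scal. replace n with (k + (n - k))%nat at 1 by lia.
    now apply splits_monomial. }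
  assert (Hsum : forall N, (N <= n)%nat ->
            splits A B n (fun t => sum_f_R0 (fun k => c k * cos t ^ k * sin t ^ (n - k)) N)).
  { induction N as [|N IH]; intros HN; simpl; [exact (Hterm O HN)|].
    apply splits_plus; [apply IH; lia | now apply Hterm]. }
  now apply Hsum.
Qed.

(** * Vanishing even moments annihilate the even part *)

Lemma RInt_nonneg_zero (h : R -> R) (a b : R) :
  (forall t, continuous h t) -> (forall t, 0 <= h t) -> a < b -> RInt h a b = 0 ->
  forall t, a <= t <= b -> h t = 0.
Proof.
  intros Hc Hpos Hab H0 t Ht.
  destruct (Rle_lt_or_eq_dec _ _ (Hpos t)) as [Hlt|Heq]; [exfalso|now symmetry].
  assert (Hloc : locally t (fun x => 0 < h x)) by (apply (Hc t); now apply open_gt).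
  destruct Hloc as [[del Hdel] Hnear]; simpl in Hnear.
  (* The neighbourhood of [t] is clipped to [[a, b]], so that endpoints are covered too; it keeps
     positive length and carries a positive integral. *)
  set (u := Rmax a (t - del / 2)). set (v := Rmin b (t + del / 2)).
  assert (Hu : a <= u /\ t - del / 2 <= u /\ u <= t).
  { unfold u. repeat split; [apply Rmax_l | apply Rmax_r | apply Rmax_lub; lra]. }
  assert (Hv : v <= b /\ v <= t + del / 2 /\ t <= v).
  { unfold v. repeat split; [apply Rmin_l | apply Rmin_r | apply Rmin_glb; lra]. }
  assert (Huv : u < v).
  { unfold u, v. apply Rmax_lub_lt; apply Rmin_glb_lt; lra. }
  assert (Hex : forall c d, ex_RInt h c d)
    by (intros; now apply (ex_RInt_continuous (V := R_CompleteNormedModule))).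
  assert (H1 : 0 <= RInt h a u) by (apply RInt_ge_0; auto; lra).
  assert (H2 : 0 <= RInt h v b) by (apply RInt_ge_0; auto; lra).
  assert (H3 : 0 < RInt h u v).
  { apply RInt_gt_0; auto. intros x Hx. apply Hnear.
    apply Rabs_def1; unfold minus, plus, opp; simpl; lra. }
  rewrite <- (RInt_Chasles h a u b), <- (RInt_Chasles h u v b) in H0 by apply Hex.
  unfold plus in H0; simpl in H0. lra.
Qed.

(** In the variable [c = P1bar A B t] the integrand becomes [g c], and the path of integration
    closes up over a period. *)
Lemma P1_mean_zero (A B : R) (g : R -> R) : (forall c, continuous g c) ->
  RInt (fun t => P1 A B t * g (P1bar A B t)) 0 (2 * PI) = 0.
Proof.
  intros Hg.
  transitivity (RInt g (P1bar A B 0) (P1bar A B (2 * PI))).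
  - apply (RInt_comp g (P1bar A B) (P1 A B)); [intros; apply Hg|].
    intros. split; [apply P1bar_is_derive | apply P1_continuous].
  - rewrite P1bar_2PI. apply (RInt_point (V := R_CompleteNormedModule)).
Qed.

Lemma even_odd_split_continuous (A B : R) (n : nat) (f e q : R -> R) :
  even_odd_split A B n f e q -> forall t, continuous f t.
Proof.
  intros [He [Hq H]] t.
  apply (continuous_ext (fun s => e (P1bar A B s) + P1 A B s * q (P1bar A B s)));
    [intros; now rewrite H|].
  apply (continuous_plus (V := R_NormedModule)); [|apply (continuous_mult (K := R_AbsRing))].
  - apply (continuous_comp (P1bar A B) e); [apply P1bar_continuous|].
    eapply parity_poly_continuous; eassumption.
  - apply P1_continuous.
  - apply (continuous_comp (P1bar A B) q); [apply P1bar_continuous|].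
    eapply parity_poly_continuous; eassumption.
Qed.

Lemma even_part_vanishes (A B : R) (m : nat) (P e q : R -> R) :
  even_odd_split A B (2 * m) P e q ->
  (forall j : nat, (j <= m)%nat ->
     RInt (fun t => P1bar A B t ^ (2 * j) * P t) 0 (2 * PI) = 0) ->
  forall t, 0 <= t <= 2 * PI -> P t = P1 A B t * q (P1bar A B t).
Proof.
  intros Hs Hm t Ht.
  assert (HPc := even_odd_split_continuous _ _ _ _ _ _ Hs).
  destruct Hs as [He [Hq H]].
  assert (Hec := parity_poly_continuous _ _ He).
  assert (Hqc := parity_poly_continuous _ _ Hq).
  assert (Hcomp : forall g : R -> R, (forall c, continuous g c) ->
            forall s, continuous (fun s => g (P1bar A B s)) s).
  { intros g Hg s. apply (continuous_comp (P1bar A B) g); [apply P1bar_continuous | apply Hg]. }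
  (* [e] contains only even powers up to [2 * m], which are the powers covered by the moment
     hypotheses. *)
  assert (Horth : RInt (fun s => P s * P1bar A B s ^ 0 * e (P1bar A B s)) 0 (2 * PI) = 0).
  { apply (parity_poly_orthogonal P (P1bar A B) _ _ _ e HPc (P1bar_continuous A B) He).
    intros j k Hjk. replace j with (2 * (m - k))%nat by lia.
    etransitivity; [|apply (Hm (m - k)%nat); lia].
    apply RInt_ext. intros s _. apply Rmult_comm. }
  assert (Hodd := P1_mean_zero A B (fun c => q c * e c)
    (fun c => continuous_mult (K := R_AbsRing) q e c (Hqc c) (Hec c))).
  (* Multiplying the splitting by [e] gives [e ^ 2 = P * e - P1 * q * e] along [P1bar], and both
     terms on the right have integral zero. *)
  assert (Hsq : RInt (fun s => e (P1bar A B s) ^ 2) 0 (2 * PI) = 0).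
  { rewrite (RInt_ext _ (fun s => minus (P s * P1bar A B s ^ 0 * e (P1bar A B s))
               (P1 A B s * (q (P1bar A B s) * e (P1bar A B s))))).
    2: { intros s _. rewrite H. unfold minus, plus, opp; simpl. ring. }
    rewrite (RInt_minus (V := R_CompleteNormedModule)).
    - rewrite Horth, Hodd. apply Rminus_0_r.
    - apply (ex_RInt_continuous (V := R_CompleteNormedModule)). intros s _.
      apply (continuous_mult (K := R_AbsRing)); [|now apply Hcomp].
      apply (continuous_mult (K := R_AbsRing)); [apply HPc|].
      apply continuous_pow, P1bar_continuous.
    - apply (ex_RInt_continuous (V := R_CompleteNormedModule)). intros s _.
      apply (continuous_mult (K := R_AbsRing)); [apply P1_continuous|].
      apply (continuous_mult (K := R_AbsRing)); now apply Hcomp. }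
  assert (Hz : e (P1bar A B t) ^ 2 = 0).
  { apply (RInt_nonneg_zero (fun s => e (P1bar A B s) ^ 2) 0 (2 * PI)); auto.
    - intros s. apply continuous_pow, Hcomp, Hec.
    - intros s. apply pow2_ge_0.
    - assert (HPI := PI_RGT_0). lra. }
  rewrite H. replace (e (P1bar A B t)) with 0; [ring|].
  symmetry. apply Rsqr_0_uniq. unfold Rsqr. simpl in Hz. now rewrite Rmult_1_r in Hz.
Qed.

(** * Reversibility, and sufficiency of the moment conditions *)

Lemma continuous_bounded (f : R -> R) (a b : R) :
  (forall t, a <= t <= b -> continuous f t) ->
  exists M, forall t, a <= t <= b -> Rabs (f t) <= M.
Proof.
  intros Hf. destruct (bounded_continuity f a b Hf) as [M HM].
  exists M. intros t Ht. left. now apply HM.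
Qed.

(* Time reversal about [tau] maps solutions to solutions. *)
Lemma reversible_solution_symmetric (p q r : R -> R) (n : nat) (tau l : R) :
  0 <= l ->
  (forall t, continuous p t) -> (forall t, continuous q t) ->
  (forall s, 0 <= s <= l -> p (tau - s) = - p (tau + s) /\ q (tau - s) = - q (tau + s)) ->
  (forall t, tau - l <= t <= tau + l ->
     is_derive r t (r t * (p t * r t + q t * r t ^ n))) ->
  r (tau + l) = r (tau - l).
Proof.
  intros Hl Hp Hq Hodd Hr.
  destruct (continuous_bounded p (tau - l) (tau + l)) as [Wp HWp]; [auto|].
  destruct (continuous_bounded q (tau - l) (tau + l)) as [Wq HWq]; [auto|].
  destruct (continuous_bounded r (tau - l) (tau + l)) as [rho Hrho].
  { intros t Ht. apply (ex_derive_continuous (K := R_AbsRing) (V := R_NormedModule)).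
    eexists. now apply Hr. }
  set (W := Rmax Wp Wq).
  set (F := fun t y => y * (p t * y + q t * y ^ n)).
  apply Rminus_diag_uniq.
  (* The sign from reversing time cancels the oddness of [p] and [q], so [r (tau + s)] and
     [r (tau - s)] solve the same equation in [s] with the same value at [s = 0]. The constant is
     the Lipschitz bound of the field on the range of [r]. *)
  apply (gronwall_zero (fun s => r (tau + s) - r (tau - s))
           (fun s => F (tau + s) (r (tau + s)) - F (tau + s) (r (tau - s)))
           (W * (2 * rho + INR (S n) * rho ^ n)) l Hl).
  - rewrite Rplus_0_r, Rminus_0_r. ring.
  - intros s Hs.
    assert (H1 := Hr (tau + s) ltac:(lra)). assert (H2 := Hr (tau - s) ltac:(lra)).
    split.
    + destruct (Hodd s Hs) as [Ho1 Ho2]. auto_derive.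
      * split; [|split; [|exact I]]; eexists; [exact H1 | exact H2].
      * replace (Derive (fun x : R => r x) (tau + s)) with (F (tau + s) (r (tau + s)))
          by (symmetry; apply is_derive_unique; exact H1).
        replace (Derive (fun x : R => r x) (tau + - s))
          with (r (tau - s) * (p (tau - s) * r (tau - s) + q (tau - s) * r (tau - s) ^ n))
          by (symmetry; apply is_derive_unique; exact H2).
        rewrite Ho1, Ho2. unfold F. ring.
    + unfold F. apply field_lipschitz.
      * eapply Rle_trans; [apply HWp; lra | apply Rmax_l].
      * eapply Rle_trans; [apply HWq; lra | apply Rmax_r].
      * apply Hrho. lra.
      * apply Hrho. lra.
Qed.

Lemma center_of_moments (m : nat) (A B : R) (P : R -> R) :
  A ^ 2 + B ^ 2 <> 0 -> homogeneous_trig_poly (2 * m) P ->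
  (forall j : nat, (j <= m)%nat ->
     RInt (fun t => P1bar A B t ^ (2 * j) * P t) 0 (2 * PI) = 0) ->
  center_at_zero (fun t r => r * (P1 A B t * r + P t * r ^ (2 * m))).
Proof.
  (* The reversal argument covers solutions of every size, so the radius 1 is arbitrary. *)
  intros HAB HP Hm. exists 1. split; [lra|]. intros r Hr _.
  destruct (homogeneous_splits A B _ P HAB HP) as [e [q Hs]].
  assert (HPc := even_odd_split_continuous _ _ _ _ _ _ Hs).
  assert (Hcomp := even_part_vanishes A B m P e q Hs Hm).
  assert (HPI := PI_RGT_0).
  assert (Hsym : forall tau l, P1 A B tau = 0 -> 0 <= l -> 0 <= tau - l -> tau + l <= 2 * PI ->
            r (tau + l) = r (tau - l)).
  { intros tau l Htau Hl H1 H2.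
    apply (reversible_solution_symmetric (P1 A B) P r (2 * m) tau l); auto.
    - apply P1_continuous.
    - intros s Hs'. destruct (P1_reflect A B tau s Htau) as [Ho1 Ho2].
      split; [assumption|]. rewrite !Hcomp, Ho1, Ho2 by lra. ring.
    - intros t Ht. apply Hr. lra. }
  (* [P1] takes the opposite values [A] and [- A] at 0 and [PI], hence vanishes in between. *)
  destruct (IVT_cor (P1 A B) 0 PI) as [tau [Htau Hzero]].
  - intros t. apply continuity_pt_filterlim, P1_continuous.
  - lra.
  - unfold P1. rewrite cos_0, sin_0, cos_PI, sin_PI. nra.
  - assert (Hzero' : P1 A B (tau + PI) = 0).
    { unfold P1 in *. rewrite neg_cos, neg_sin. lra. }
    (* The reflection about [tau] carries 0 to [2 * tau], and the one about [tau + PI] carries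
       [2 * tau] to [2 * PI]; as [0 <= tau <= PI], both stay within the period. *)
    assert (H1 := Hsym tau tau Hzero ltac:(lra) ltac:(lra) ltac:(lra)).
    assert (H2 := Hsym (tau + PI) (PI - tau) Hzero' ltac:(lra) ltac:(lra) ltac:(lra)).
    replace (tau + PI + (PI - tau)) with (2 * PI) in H2 by ring.
    replace (tau + PI - (PI - tau)) with (tau + tau) in H2 by ring.
    rewrite Rminus_diag in H1. now rewrite H2, H1.
Qed.

(** * Expansion of negative powers and identification of coefficients *)

Lemma inv_one_minus_bound (t : R) : Rabs t <= 1 / 2 -> 0 < / (1 - t) <= 2.
Proof.
  intros Ht. apply Rabs_le_between in Ht. split.
  - apply Rinv_0_lt_compat. lra.
  - replace 2 with (/ (1 / 2)) by field. apply Rinv_le_contravar; lra.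
Qed.

(** On this range [/ (1 - t)] lies in [(0, 2]] and is 4-Lipschitz; the remaining factor is the
    Lipschitz constant of the power on [[-2, 2]]. *)
Lemma inv_pow_lipschitz (n : nat) (s t : R) : Rabs s <= 1 / 2 -> Rabs t <= 1 / 2 ->
  Rabs (/ (1 - s) ^ S n - / (1 - t) ^ S n) <= INR (S n) * 2 ^ n * 4 * Rabs (s - t).
Proof.
  intros Hs Ht.
  destruct (inv_one_minus_bound s Hs) as [Hs1 Hs2].
  destruct (inv_one_minus_bound t Ht) as [Ht1 Ht2].
  apply Rabs_le_between in Hs. apply Rabs_le_between in Ht.
  rewrite <- !pow_inv.
  eapply Rle_trans; [apply (pow_lipschitz 2); rewrite Rabs_pos_eq; lra|].
  rewrite (Rmult_assoc _ 4). apply Rmult_le_compat_l.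
  - apply Rmult_le_pos; [apply pos_INR | apply pow_le; lra].
  - replace (/ (1 - s) - / (1 - t)) with (/ (1 - s) * / (1 - t) * (s - t)) by (field; lra).
    rewrite !Rabs_mult, (Rabs_pos_eq (/ (1 - s))), (Rabs_pos_eq (/ (1 - t))) by lra.
    apply Rmult_le_compat_r; [apply Rabs_pos|].
    replace 4 with (2 * 2) by ring. apply Rmult_le_compat; lra.
Qed.

(* Induction through [(1 - t)^-(n+2) = (1 - t)^-(n+1) + t (1 - t)^-(n+2)]; only
   the positivity of the coefficients matters. *)
Lemma inv_pow_expansion (n N : nat) :
  exists (c : nat -> R) (K : R), (forall k, 0 < c k) /\ 0 <= K /\
    forall t, Rabs t <= 1 / 2 ->
      Rabs (/ (1 - t) ^ S n - sum_f_R0 (fun k => c k * t ^ k) N) <= K * Rabs t ^ S N.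
Proof.
  revert N. induction n as [|n IHn]; intros N.
  - exists (fun _ => 1), 2. split; [intros; lra|]. split; [lra|]. intros t Ht.
    destruct (inv_one_minus_bound t Ht) as [H1 H2].
    apply Rabs_le_between in Ht.
    rewrite (sum_eq _ (fun k => t ^ k)) by (intros; ring).
    rewrite tech3 by lra.
    replace (/ (1 - t) ^ 1 - (1 - t ^ S N) / (1 - t)) with (/ (1 - t) * t ^ S N)
      by (simpl; field; lra).
    rewrite Rabs_mult, Rabs_pos_eq, <- RPow_abs by lra.
    apply Rmult_le_compat_r; [apply pow_le, Rabs_pos | assumption].
  - assert (Hrec : forall t, Rabs t <= 1 / 2 ->
              / (1 - t) ^ S (S n) = / (1 - t) ^ S n + t * / (1 - t) ^ S (S n)).
    { intros t Ht. apply Rabs_le_between in Ht.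
      assert ((1 - t) ^ n <> 0) by (apply pow_nonzero; lra).
      simpl. field. split; [assumption | lra]. }
    induction N as [|N IHN].
    + destruct (IHn O) as [c [K [Hc [HK H]]]].
      (* The added [2 ^ S (S n)] bounds the factor of [t] in the recursion. *)
      exists c, (K + 2 ^ S (S n)).
      assert (H2 : 0 <= 2 ^ S (S n)) by (apply pow_le; lra).
      split; [assumption|]. split; [lra|].
      intros t Ht. rewrite Hrec by assumption.
      destruct (inv_one_minus_bound t Ht) as [Ht1 Ht2].
      match goal with |- Rabs (?a + ?b - ?c) <= _ =>
        replace (a + b - c) with ((a - c) + b) by ring end.
      eapply Rle_trans; [apply Rabs_triang|]. rewrite Rmult_plus_distr_r.
      apply Rplus_le_compat; [now apply H|].
      rewrite Rabs_mult, pow_1, Rmult_comm.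
      apply Rmult_le_compat_r; [apply Rabs_pos|].
      rewrite <- pow_inv, Rabs_pos_eq by (apply pow_le; lra).
      apply pow_incr. lra.
    + destruct IHN as [c' [K' [Hc' [HK' H']]]].
      destruct (IHn (S N)) as [c [K [Hc [HK H]]]].
      (* Coefficients read off the recursion: multiplication by [t] shifts [c'] by one index, and
         sums of positive numbers stay positive. *)
      set (c2 := fun k => match k with O => c O | S k' => c (S k') + c' k' end).
      exists c2, (K + K'). split; [|split; [lra|]].
      { intros [|k]; simpl; [apply Hc|]. specialize (Hc (S k)). specialize (Hc' k). lra. }
      intros t Ht.
      assert (Hsum : forall M, sum_f_R0 (fun k => c2 k * t ^ k) (S M)
                = sum_f_R0 (fun k => c k * t ^ k) (S M)
                  + t * sum_f_R0 (fun k => c' k * t ^ k) M).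
      { induction M as [|M IHM]; [simpl; ring|].
        rewrite tech5, IHM, (tech5 _ (S M)), (tech5 _ M). simpl. ring. }
      rewrite Hsum, Hrec by assumption.
      match goal with |- Rabs (?a + t * ?b - (?c + t * ?d)) <= _ =>
        replace (a + t * b - (c + t * d)) with ((a - c) + t * (b - d)) by ring end.
      eapply Rle_trans; [apply Rabs_triang|]. rewrite Rmult_plus_distr_r.
      apply Rplus_le_compat; [now apply H|].
      rewrite Rabs_mult.
      replace (K' * Rabs t ^ S (S N)) with (Rabs t * (K' * Rabs t ^ S N)) by (simpl; ring).
      apply Rmult_le_compat_l; [apply Rabs_pos | now apply H'].
Qed.

Lemma sum_pow_abs_le (a : nat -> R) (N : nat) (x : R) : Rabs x <= 1 ->
  Rabs (sum_f_R0 (fun k => a k * x ^ k) N) <= sum_f_R0 (fun k => Rabs (a k)) N.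
Proof.
  intros Hx. eapply Rle_trans; [apply Rsum_abs|]. apply sum_Rle. intros k _.
  rewrite Rabs_mult. rewrite <- (Rmult_1_r (Rabs (a k))) at 2.
  apply Rmult_le_compat_l; [apply Rabs_pos | now apply pow_abs_le_1].
Qed.

Lemma linear_bound_zero (a K eta : R) : 0 < eta ->
  (forall x, 0 < x < eta -> Rabs a <= K * x) -> a = 0.
Proof.
  intros Heta H.
  assert (HK : 0 <= K).
  { assert (H1 := H (eta / 2) ltac:(lra)). assert (H2 := Rabs_pos a). nra. }
  destruct (Req_dec a 0) as [|Ha]; [assumption|exfalso].
  apply Rabs_pos_lt in Ha.
  (* At this point [K * x] is at most half of [Rabs a]; using [K + 1] keeps the denominator positive
     when [K = 0]. *)
  set (x := Rmin (eta / 2) (Rabs a / (2 * (K + 1)))).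
  assert (Hpos : 0 < Rabs a / (2 * (K + 1))) by (apply Rdiv_lt_0_compat; lra).
  assert (Hx : 0 < x < eta).
  { unfold x. split; [apply Rmin_glb_lt; lra|].
    eapply Rle_lt_trans; [apply Rmin_l | lra]. }
  specialize (H x Hx).
  assert (Hx2 : x <= Rabs a / (2 * (K + 1))) by apply Rmin_r.
  assert (Hx3 : (K + 1) * x <= Rabs a / 2).
  { replace (Rabs a / 2) with ((K + 1) * (Rabs a / (2 * (K + 1)))) by (field; lra).
    apply Rmult_le_compat_l; lra. }
  lra.
Qed.

(** The constant coefficient is [O (x)] as [x] tends to 0, hence zero; dividing by [x] then lowers
    the degree and the order of the bound together. *)
Lemma small_polynomial_zero (N : nat) (a : nat -> R) (K eta : R) : 0 < eta ->
  (forall x, 0 < x < eta -> Rabs (sum_f_R0 (fun k => a k * x ^ k) N) <= K * x ^ S N) ->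
  forall k, (k <= N)%nat -> a k = 0.
Proof.
  revert a. induction N as [|N IH]; intros a Heta H.
  - intros k Hk. replace k with O by lia. apply (linear_bound_zero _ K eta Heta).
    intros x Hx. specialize (H x Hx). simpl in H. now rewrite !Rmult_1_r in H.
  - assert (Hsplit : forall x, sum_f_R0 (fun k => a k * x ^ k) (S N)
              = a O + x * sum_f_R0 (fun k => a (S k) * x ^ k) N).
    { intros x. rewrite decomp_sum by lia. simpl pred. rewrite scal_sum.
      simpl pow at 1. rewrite Rmult_1_r. f_equal. apply sum_eq. intros; simpl; ring. }
    assert (H0 : a O = 0).
    { set (M := sum_f_R0 (fun k => Rabs (a (S k))) N).
      apply (linear_bound_zero _ (Rabs K + M) (Rmin eta 1)); [apply Rmin_glb_lt; lra|].
      intros x Hx.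
      assert (Hx1 : x < eta) by (eapply Rlt_le_trans; [apply Hx | apply Rmin_l]).
      assert (Hx2 : x < 1) by (eapply Rlt_le_trans; [apply Hx | apply Rmin_r]).
      specialize (H x ltac:(lra)). rewrite Hsplit in H.
      set (s := sum_f_R0 (fun k => a (S k) * x ^ k) N) in *.
      assert (Hs : Rabs s <= M).
      { apply (sum_pow_abs_le (fun k => a (S k))). rewrite Rabs_pos_eq; lra. }
      replace (a O) with ((a O + x * s) - x * s) by ring.
      eapply Rle_trans; [apply Rabs_triang|].
      rewrite Rabs_Ropp, Rabs_mult, (Rabs_pos_eq x) by lra.
      assert (Hp : Rabs (x ^ S N) <= 1) by (apply pow_abs_le_1; rewrite Rabs_pos_eq; lra).
      assert (Hp' : 0 <= x ^ S N) by (apply pow_le; lra).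
      rewrite Rabs_pos_eq in Hp by assumption.
      assert (HKx : K * x ^ S (S N) <= Rabs K * x).
      { replace (K * x ^ S (S N)) with ((K * x) * x ^ S N) by (simpl; ring).
        apply Rle_trans with (Rabs K * x * x ^ S N).
        - apply Rmult_le_compat_r; [assumption|].
          apply Rmult_le_compat_r; [lra | apply Rle_abs].
        - rewrite <- (Rmult_1_r (Rabs K * x)) at 2. apply Rmult_le_compat_l; [|assumption].
          apply Rmult_le_pos; [apply Rabs_pos | lra]. }
      assert (x * Rabs s <= x * M) by (apply Rmult_le_compat_l; lra).
      lra. }
    intros [|k] Hk; [assumption|].
    apply (IH (fun k => a (S k))); [assumption | | lia].
    intros x Hx. specialize (H x Hx).
    rewrite Hsplit, H0, Rplus_0_l, Rabs_mult, (Rabs_pos_eq x) in H by lra.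
    apply (Rmult_le_reg_l x); [lra|].
    replace (x * (K * x ^ S N)) with (K * x ^ S (S N)) by (simpl; ring). assumption.
Qed.

(** * Small positive solutions, and necessity of the moment conditions *)

Lemma derivative_bound_increment (z z' : R -> R) (M t : R) : 0 <= t ->
  (forall s, 0 <= s <= t -> is_derive z s (z' s) /\ Rabs (z' s) <= M) ->
  Rabs (z t - z 0) <= M * t.
Proof.
  intros Ht Hz.
  destruct (MVT_gen z 0 t z') as [c [Hc Heq]].
  - intros s Hs. rewrite Rmin_left, Rmax_right in Hs by lra. apply Hz. lra.
  - intros s Hs. rewrite Rmin_left, Rmax_right in Hs by lra.
    apply continuity_pt_filterlim, (ex_derive_continuous (K := R_AbsRing) (V := R_NormedModule)).
    eexists; apply Hz; lra.
  - rewrite Rmin_left, Rmax_right in Hc by lra.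
    rewrite Heq, Rabs_mult, Rminus_0_r, (Rabs_pos_eq t) by lra.
    apply Rmult_le_compat_r; [assumption | now apply Hz].
Qed.

(** Since [PI <= 4], the window [[-9, 9]] contains the period in its interior. For
    [rho = 2 * r0 <= 1] one has [rho ^ n <= rho], so the Lipschitz constant is at most
    [W * ((INR n + 3) * rho)] and the last hypothesis is the contraction condition. *)
Lemma positive_solution_exists (p q : R -> R) (n : nat) (W r0 : R) :
  (1 <= n)%nat ->
  (forall t, continuous p t) -> (forall t, continuous q t) ->
  (forall t, -9 <= t <= 9 -> Rabs (p t) <= W) ->
  (forall t, -9 <= t <= 9 -> Rabs (q t) <= W) ->
  0 < r0 -> 2 * r0 <= 1 -> 9 * (W * ((INR n + 3) * (2 * r0))) <= 1 / 4 ->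
  exists r : R -> R, r 0 = r0 /\
    forall t, 0 <= t <= 2 * PI ->
      is_derive r t (r t * (p t * r t + q t * r t ^ n)) /\ r0 / 2 <= r t <= 3 * r0 / 2.
Proof.
  intros Hn Hp Hq HWp HWq Hr0 Hr1 Hsmall.
  assert (HW : 0 <= W).
  { apply Rle_trans with (2 := HWp 0 ltac:(lra)). apply Rabs_pos. }
  set (rho := 2 * r0) in *.
  assert (Hrho : 0 < rho) by (unfold rho; lra).
  assert (Habs : 2 * Rabs r0 = rho) by (rewrite Rabs_pos_eq; unfold rho; lra).
  assert (Hpow : rho ^ n <= rho).
  { destruct n as [|n]; [lia|]. simpl. rewrite <- (Rmult_1_r rho) at 3.
    apply Rmult_le_compat_l; [lra|].
    eapply Rle_trans; [apply Rle_abs|]. apply pow_abs_le_1.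
    rewrite Rabs_pos_eq; lra. }
  assert (Hpow0 : 0 <= rho ^ n) by (apply pow_le; lra).
  assert (HINR := pos_INR (S n)).
  assert (Hcoef : 0 <= 2 * rho + INR (S n) * rho ^ n).
  { apply Rplus_le_le_0_compat; [lra | now apply Rmult_le_pos]. }
  destruct (small_solution_exists (fun t y => y * (p t * y + q t * y ^ n)) 9
              (W * (2 * rho + INR (S n) * rho ^ n)) r0) as [r [Hr Hsol]].
  - lra.
  - now apply Rmult_le_pos.
  - eapply Rle_trans with (2 := Hsmall).
    apply Rmult_le_compat_l; [lra|]. apply Rmult_le_compat_l; [assumption|].
    replace ((INR n + 3) * rho) with (2 * rho + INR (S n) * rho) by (rewrite S_INR; ring).
    apply Rplus_le_compat_l. now apply Rmult_le_compat_l.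
  - intros u Hu t. apply (continuous_mult (K := R_AbsRing)); [apply Hu|].
    apply (continuous_plus (V := R_NormedModule)); apply (continuous_mult (K := R_AbsRing)); auto.
    now apply continuous_pow.
  - intros s. ring.
  - rewrite Habs. intros s y y' Hs Hy Hy'. apply Rabs_le_between in Hs.
    apply field_lipschitz; auto.
  - exists r. split; [assumption|]. intros t Ht.
    assert (HPI := PI_4). assert (HPI0 := PI_RGT_0).
    destruct (Hsol t) as [H1 H2]; [rewrite Rabs_pos_eq; lra|].
    split; [exact H1|]. rewrite (Rabs_pos_eq r0) in H2 by lra.
    apply Rabs_le_between in H2. lra.
Qed.

(** The derivative of [/ r] is [- P1 - P * r ^ n], and adding [P1bar] removes the term [P1]. *)
Lemma reciprocal_is_derive (A B : R) (P r : R -> R) (n : nat) (t : R) :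
  r t <> 0 ->
  is_derive r t (r t * (P1 A B t * r t + P t * r t ^ S n)) ->
  is_derive (fun s => / r s + P1bar A B s) t (- (P t * r t ^ n)).
Proof.
  intros Hr Hd.
  replace (- (P t * r t ^ n))
    with (- (r t * (P1 A B t * r t + P t * r t ^ S n)) / r t ^ 2 + P1 A B t)
    by (simpl; field; assumption).
  apply (is_derive_plus (K := R_AbsRing) (V := R_NormedModule)).
  - now apply is_derive_inv.
  - apply P1bar_is_derive.
Qed.

(** With [z = / r + P1bar], the derivative of [z ^ S n] is [- INR (S n) * P * (r * z) ^ n], where
    [r * z = 1 + P1bar * r]. As [z] returns to its initial value, this integrates to zero. *)
Lemma periodic_solution_identity (A B : R) (P r : R -> R) (n : nat) :
  (forall t, continuous P t) ->
  (forall t, 0 <= t <= 2 * PI -> r t <> 0 /\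
     is_derive r t (r t * (P1 A B t * r t + P t * r t ^ S n))) ->
  r (2 * PI) = r 0 ->
  is_RInt (fun t => P t * (1 + P1bar A B t * r t) ^ n) 0 (2 * PI) 0.
Proof.
  intros HP Hr Hper. assert (HPI := PI_RGT_0).
  set (z := fun s => / r s + P1bar A B s).
  assert (Hz : forall t, 0 <= t <= 2 * PI -> is_derive z t (- (P t * r t ^ n))).
  { intros t Ht. destruct (Hr t Ht) as [H1 H2]. now apply reciprocal_is_derive. }
  assert (Hzc : forall t, 0 <= t <= 2 * PI -> continuous z t).
  { intros t Ht. apply (ex_derive_continuous (K := R_AbsRing) (V := R_NormedModule)).
    eexists; now apply Hz. }
  assert (Hrc : forall t, 0 <= t <= 2 * PI -> continuous r t).
  { intros t Ht. apply (ex_derive_continuous (K := R_AbsRing) (V := R_NormedModule)).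
    eexists; now apply Hr. }
  assert (HI : is_RInt (fun t => INR (S n) * - (P t * r t ^ n) * z t ^ n) 0 (2 * PI)
                 (minus (z (2 * PI) ^ S n) (z 0 ^ S n))).
  { apply (is_RInt_derive (V := R_CompleteNormedModule) (fun t => z t ^ S n)).
    - intros t Ht. rewrite Rmin_left, Rmax_right in Ht by lra.
      apply (is_derive_pow z (S n) t). now apply Hz.
    - intros t Ht. rewrite Rmin_left, Rmax_right in Ht by lra.
      apply (continuous_mult (K := R_AbsRing)); [|now apply continuous_pow, Hzc].
      apply (continuous_mult (K := R_AbsRing)); [apply continuous_const|].
      apply (continuous_opp (V := R_NormedModule)).
      apply (continuous_mult (K := R_AbsRing)); [apply HP | now apply continuous_pow, Hrc]. }
  replace (minus (z (2 * PI) ^ S n) (z 0 ^ S n)) with 0 in HI.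
  2: { unfold z. rewrite Hper, P1bar_2PI. unfold minus, plus, opp; simpl. ring. }
  assert (HI' : is_RInt (fun t => - / INR (S n) * (INR (S n) * - (P t * r t ^ n) * z t ^ n))
                  0 (2 * PI) (- / INR (S n) * 0))
    by exact (is_RInt_scal (V := R_NormedModule) _ _ _ (- / INR (S n)) _ HI).
  rewrite Rmult_0_r in HI'.
  apply is_RInt_ext with (2 := HI'). intros t Ht.
  rewrite Rmin_left, Rmax_right in Ht by lra.
  destruct (Hr t ltac:(lra)) as [Hr0 _].
  assert (Hzr : 1 + P1bar A B t * r t = r t * z t) by (unfold z; field; assumption).
  rewrite Hzr, Rpow_mult_distr.
  assert (HINR := not_0_INR (S n) ltac:(lia)).
  match goal with |- ?a = ?b => change (@eq R a b) end.
  field. assumption.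
Qed.

Lemma RInt_weighted_sum (w x : R -> R) (c : nat -> R) (y a b : R) (N : nat) :
  (forall t, continuous w t) -> (forall t, continuous x t) ->
  is_RInt (fun t => w t * sum_f_R0 (fun k => c k * (x t * y) ^ k) N) a b
    (sum_f_R0 (fun k => c k * RInt (fun t => x t ^ k * w t) a b * y ^ k) N).
Proof.
  intros Hw Hx.
  assert (Hterm : forall k, is_RInt (fun t => w t * (c k * (x t * y) ^ k)) a b
                    (c k * RInt (fun t => x t ^ k * w t) a b * y ^ k)).
  { intros k.
    assert (H : is_RInt (fun t => x t ^ k * w t) a b (RInt (fun t => x t ^ k * w t) a b)).
    { apply (RInt_correct (V := R_CompleteNormedModule)),
        (ex_RInt_continuous (V := R_CompleteNormedModule)).
      intros t _. apply (continuous_mult (K := R_AbsRing)); auto. now apply continuous_pow. }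
    apply (is_RInt_scal (V := R_NormedModule) _ _ _ (c k * y ^ k)) in H.
    change (is_RInt (fun t => c k * y ^ k * (x t ^ k * w t)) a b
              (c k * y ^ k * RInt (fun t => x t ^ k * w t) a b)) in H.
    replace (c k * RInt (fun t => x t ^ k * w t) a b * y ^ k)
      with (c k * y ^ k * RInt (fun t => x t ^ k * w t) a b)
      by (rewrite Rmult_assoc, (Rmult_comm (y ^ k)), <- Rmult_assoc; reflexivity).
    apply is_RInt_ext with (2 := H). intros t _. rewrite Rpow_mult_distr.
    match goal with |- ?a = ?b => change (@eq R a b) end. ring. }
  induction N as [|N IH]; simpl; [apply (Hterm O)|].
  apply (is_RInt_ext (fun t => plus (w t * sum_f_R0 (fun k => c k * (x t * y) ^ k) N)
                               (w t * (c (S N) * (x t * y) ^ S N)))).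
  - intros t _. unfold plus; simpl. ring.
  - apply (is_RInt_plus (V := R_NormedModule)); [apply IH | apply (Hterm (S N))].
Qed.

(* With [z = 1 / r + P1bar] one has [1 + P1bar r = (1 - P1bar / z)^-1], and [1 / z]
   stays within [O (x0 ^ (n + 2))] of its initial value [x0]. *)
Lemma near_constant_amplitude (A B W x0 : R) (P r : R -> R) (n : nat) :
  (forall t, 0 <= t <= 2 * PI -> Rabs (P t) <= W /\ Rabs (P1bar A B t) <= W) ->
  0 < x0 -> 100 * (W * x0) <= 1 ->
  (forall t, 0 <= t <= 2 * PI ->
     is_derive r t (r t * (P1 A B t * r t + P t * r t ^ S n)) /\ 0 < r t <= 3 * x0) ->
  / r 0 + P1bar A B 0 = / x0 ->
  forall t, 0 <= t <= 2 * PI ->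
    exists s, Rabs s <= 1 / 2 /\ 1 + P1bar A B t * r t = / (1 - s) /\
      Rabs (s - P1bar A B t * x0) <= 144 * W ^ 2 * 3 ^ n * x0 ^ S (S n).
Proof.
  intros HW Hx0 Hsmall Hr Hinit t Ht.
  destruct (HW t Ht) as [HWP HWC].
  assert (HW0 : 0 <= W) by (apply Rle_trans with (2 := HWP); apply Rabs_pos).
  destruct (Hr t Ht) as [_ [Hrt1 Hrt2]].
  set (C := P1bar A B t) in *. set (y := r t) in *.
  assert (HCy : Rabs (C * y) <= 3 / 100).
  { rewrite Rabs_mult, (Rabs_pos_eq y) by lra.
    apply Rle_trans with (W * (3 * x0)); [|lra].
    apply Rmult_le_compat; auto using Rabs_pos; lra. }
  apply Rabs_le_between in HCy.
  set (z := fun s => / r s + P1bar A B s).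
  (* [x] is [1 / z] at time [t]; the witness is [s = C * x], because [1 - C * x = / (1 + C * y)]. *)
  set (x := y / (1 + C * y)).
  assert (Hx : 0 < x <= 4 * x0).
  { unfold x. split; [apply Rdiv_lt_0_compat; lra|].
    apply (Rmult_le_reg_r (1 + C * y)); [lra|].
    unfold Rdiv. rewrite Rmult_assoc, Rinv_l by lra. nra. }
  assert (Hzx : z t = / x) by (unfold z, x; fold y C; field; lra).
  assert (Hinc : Rabs (z t - z 0) <= W * (3 * x0) ^ n * t).
  { apply (derivative_bound_increment z (fun s => - (P s * r s ^ n))); [lra|].
    intros s Hs. destruct (Hr s ltac:(lra)) as [Hd Hb]. destruct (HW s ltac:(lra)) as [HPs _].
    split; [apply reciprocal_is_derive; [lra | exact Hd]|].
    rewrite Rabs_Ropp, Rabs_mult, <- RPow_abs, (Rabs_pos_eq (r s)) by lra.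
    apply Rmult_le_compat; auto using Rabs_pos; [apply pow_le; lra | apply pow_incr; lra]. }
  assert (Hz0 : z 0 = / x0) by exact Hinit.
  assert (HPI := PI_4).
  assert (Hpow : 0 <= W * (3 * x0) ^ n) by (apply Rmult_le_pos; [|apply pow_le]; lra).
  (* The factor 9 bounds the elapsed time, which is at most [2 * PI <= 8]. *)
  assert (Hinc' : Rabs (/ x - / x0) <= 9 * (W * (3 * x0) ^ n)).
  { rewrite <- Hzx, <- Hz0. eapply Rle_trans; [apply Hinc|].
    rewrite Rmult_comm. apply Rmult_le_compat_r; lra. }
  exists (C * x). split; [|split].
  - rewrite Rabs_mult, (Rabs_pos_eq x) by lra.
    apply Rle_trans with (W * (4 * x0)); [|lra].
    apply Rmult_le_compat; auto using Rabs_pos; lra.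
  - unfold x. field. split; [|lra].
    replace (1 + C * y - C * y) with 1 by ring. lra.
  (* Passing from reciprocals back to [x - x0] gains the factor [x * x0], that is two powers of
     [x0]. The constants multiply to 36, below the stated 144. *)
  - replace (C * x - C * x0) with (- (C * ((x * x0) * (/ x - / x0)))) by (field; lra).
    rewrite Rabs_Ropp, !Rabs_mult, (Rabs_pos_eq x), (Rabs_pos_eq x0) by lra.
    apply Rle_trans with (W * ((4 * x0 * x0) * (9 * (W * (3 * x0) ^ n)))).
    + apply Rmult_le_compat; auto using Rabs_pos.
      * apply Rmult_le_pos; [apply Rmult_le_pos; lra | apply Rabs_pos].
      * apply Rmult_le_compat; auto using Rabs_pos; [apply Rmult_le_pos; lra|].
        apply Rmult_le_compat_r; lra.
    + rewrite Rpow_mult_distr. simpl.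
      assert (0 <= W * (W * (3 ^ n * (x0 * (x0 * x0 ^ n)))))
        by (repeat apply Rmult_le_pos; try apply pow_le; lra).
      lra.
Qed.

(** The integral of [P * / (1 - s) ^ S n] vanishes by periodicity. Replacing [s] by [P1bar * x0]
    costs the Lipschitz constant times the amplitude error, truncating the expansion costs the [K]
    term, and both are of order [S (S (S n))] in [x0]. The factor 9 bounds the period. *)
Lemma moment_series_bound (A B W x0 : R) (P r : R -> R) (n : nat) (c : nat -> R) (K : R) :
  (forall t, continuous P t) -> 1 <= W ->
  (forall t, 0 <= t <= 2 * PI -> Rabs (P t) <= W /\ Rabs (P1bar A B t) <= W) ->
  0 < x0 -> 100 * (W * x0) <= 1 ->
  (forall t, 0 <= t <= 2 * PI ->
     is_derive r t (r t * (P1 A B t * r t + P t * r t ^ S (S n))) /\ 0 < r t <= 3 * x0) ->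
  / r 0 + P1bar A B 0 = / x0 -> r (2 * PI) = r 0 -> 0 <= K ->
  (forall t, Rabs t <= 1 / 2 ->
     Rabs (/ (1 - t) ^ S n - sum_f_R0 (fun k => c k * t ^ k) (S (S n)))
       <= K * Rabs t ^ S (S (S n))) ->
  Rabs (sum_f_R0 (fun k => c k * RInt (fun t => P1bar A B t ^ k * P t) 0 (2 * PI) * x0 ^ k)
          (S (S n)))
    <= 9 * (W * (INR (S n) * 2 ^ n * 4 * (144 * W ^ 2 * 3 ^ S n) + K * W ^ S (S (S n))))
       * x0 ^ S (S (S n)).
Proof.
  intros HP HW1 HW Hx0 Hsmall Hr Hinit Hper HK Hexp.
  assert (HPI := PI_4). assert (HPI0 := PI_RGT_0).
  set (M := W * (INR (S n) * 2 ^ n * 4 * (144 * W ^ 2 * 3 ^ S n) + K * W ^ S (S (S n)))).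
  set (S3 := S (S (S n))) in *.
  assert (HM : 0 <= M * x0 ^ S3).
  { apply Rmult_le_pos; [|apply pow_le; lra].
    apply Rmult_le_pos; [lra|]. apply Rplus_le_le_0_compat.
    - repeat apply Rmult_le_pos; try apply pow_le; try apply pos_INR; lra.
    - apply Rmult_le_pos; [assumption | apply pow_le; lra]. }
  assert (H0 : is_RInt (fun t => P t * (1 + P1bar A B t * r t) ^ S n) 0 (2 * PI) 0).
  { apply periodic_solution_identity; auto.
    intros t Ht. destruct (Hr t Ht) as [H1 H2]. split; [lra | exact H1]. }
  assert (H1 := RInt_weighted_sum P (P1bar A B) c x0 0 (2 * PI) (S (S n)) HP
                  (P1bar_continuous A B)).
  set (J := sum_f_R0 _ (S (S n))) in *.
  assert (H2 : is_RInt (fun t => P t * sum_f_R0 (fun k => c k * (P1bar A B t * x0) ^ k) (S (S n))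
                          - P t * (1 + P1bar A B t * r t) ^ S n) 0 (2 * PI) (J - 0))
    by exact (is_RInt_minus (V := R_NormedModule) _ _ _ _ _ _ H1 H0).
  rewrite Rminus_0_r in H2.
  rewrite <- (is_RInt_unique (V := R_CompleteNormedModule) _ _ _ _ H2).
  eapply Rle_trans; [apply (abs_RInt_le_const _ 0 (2 * PI) (M * x0 ^ S3))|].
  - lra.
  - now exists J.
  - intros t Ht.
    destruct (near_constant_amplitude A B W x0 P r (S n) HW Hx0 Hsmall Hr Hinit t Ht)
      as [s [Hs1 [Hs2 Hs3]]].
    destruct (HW t Ht) as [HWP HWC].
    rewrite Hs2, pow_inv. set (C := P1bar A B t) in *.
    assert (HCx : Rabs (C * x0) <= W * x0).
    { rewrite Rabs_mult, (Rabs_pos_eq x0) by lra. apply Rmult_le_compat_r; lra. }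
    assert (HCx' : Rabs (C * x0) <= 1 / 2) by lra.
    specialize (Hexp (C * x0) HCx').
    assert (Hlip := inv_pow_lipschitz n s (C * x0) Hs1 HCx').
    set (sig := sum_f_R0 _ _) in *.
    replace (P t * sig - P t * / (1 - s) ^ S n)
      with (- (P t * ((/ (1 - s) ^ S n - / (1 - C * x0) ^ S n)
                      + (/ (1 - C * x0) ^ S n - sig)))) by ring.
    rewrite Rabs_Ropp, Rabs_mult. unfold M. rewrite Rmult_assoc.
    apply Rmult_le_compat; auto using Rabs_pos.
    eapply Rle_trans; [apply Rabs_triang|]. rewrite Rmult_plus_distr_r.
    apply Rplus_le_compat.
    + eapply Rle_trans; [apply Hlip|]. rewrite (Rmult_assoc _ (144 * W ^ 2 * 3 ^ S n)).
      apply Rmult_le_compat_l; [|exact Hs3].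
      repeat apply Rmult_le_pos; try apply pow_le; try apply pos_INR; lra.
    + eapply Rle_trans; [apply Hexp|]. rewrite Rmult_assoc, <- Rpow_mult_distr.
      apply Rmult_le_compat_l; [assumption|]. apply pow_incr.
      split; [apply Rabs_pos | assumption].
  - rewrite Rminus_0_r, (Rmult_assoc 9). apply Rmult_le_compat_r; lra.
Qed.

Lemma moments_of_center (m : nat) (A B : R) (P : R -> R) : (1 <= m)%nat ->
  (forall t, continuous P t) ->
  center_at_zero (fun t r => r * (P1 A B t * r + P t * r ^ (2 * m))) ->
  forall k : nat, (k <= 2 * m)%nat ->
    RInt (fun t => P1bar A B t ^ k * P t) 0 (2 * PI) = 0.
Proof.
  intros Hm HP Hc.
  (* With [2 * m = S (S n)], the exponent [2 * m - 1] of the integral identity is [S n]. *)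
  assert (Hn : exists n, (2 * m = S (S n))%nat) by (exists (2 * m - 2)%nat; lia).
  destruct Hn as [n Hn]. rewrite Hn in *. clear m Hm Hn.
  destruct Hc as [eps [Heps Hc]].
  assert (HPI := PI_4). assert (HPI0 := PI_RGT_0).
  destruct (continuous_bounded P (-9) 9) as [W1 HW1]; [auto|].
  destruct (continuous_bounded (P1 A B) (-9) 9) as [W2 HW2]; [intros; apply P1_continuous|].
  destruct (continuous_bounded (P1bar A B) (-9) 9) as [W3 HW3];
    [intros; apply P1bar_continuous|].
  set (W := Rmax 1 (Rmax W1 (Rmax W2 W3))).
  assert (HWge : 1 <= W /\ W1 <= W /\ W2 <= W /\ W3 <= W).
  { unfold W. assert (Ha := Rmax_l 1 (Rmax W1 (Rmax W2 W3))).
    assert (Hb := Rmax_r 1 (Rmax W1 (Rmax W2 W3))).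
    assert (Hb1 := Rmax_l W1 (Rmax W2 W3)). assert (Hb2 := Rmax_r W1 (Rmax W2 W3)).
    assert (Hb3 := Rmax_l W2 W3). assert (Hb4 := Rmax_r W2 W3). lra. }
  destruct HWge as [HWa [HWb [HWc HWd]]].
  assert (HINR := pos_INR (S (S n))). set (b := INR (S (S n))) in *.
  (* The first bound keeps [r0 <= 2 * x0] below [eps]; the second gives both the contraction
     condition and [100 * (W * x0) <= 1]. *)
  set (eta := Rmin (eps / 2) (/ (200 * (W * (b + 3))))).
  assert (Hb0 : 0 < W * (b + 3)) by (apply Rmult_lt_0_compat; lra).
  assert (Heta : 0 < eta).
  { unfold eta. apply Rmin_glb_lt; [lra|]. apply Rinv_0_lt_compat. lra. }
  destruct (inv_pow_expansion n (S (S n))) as [c [K [Hcpos [HK Hexp]]]].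
  assert (Hall : forall k, (k <= S (S n))%nat ->
            c k * RInt (fun t => P1bar A B t ^ k * P t) 0 (2 * PI) = 0).
  { eapply (small_polynomial_zero (S (S n))); [exact Heta|]. intros x0 [Hx0 Hx0e].
    assert (Hxeps : 2 * x0 < eps).
    { assert (H := Rmin_l (eps / 2) (/ (200 * (W * (b + 3))))). fold eta in H. lra. }
    assert (Hxs : 200 * (W * (b + 3)) * x0 <= 1).
    { assert (H := Rmin_r (eps / 2) (/ (200 * (W * (b + 3))))). fold eta in H.
      apply Rle_trans with (200 * (W * (b + 3)) * / (200 * (W * (b + 3)))).
      - apply Rmult_le_compat_l; lra.
      - rewrite Rinv_r by lra. lra. }
    assert (HbWx : 0 <= b * (W * x0)) by (repeat apply Rmult_le_pos; lra).
    assert (HWx : x0 <= W * x0).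
    { rewrite <- (Rmult_1_l x0) at 1. apply Rmult_le_compat_r; lra. }
    set (C0 := P1bar A B 0).
    assert (HC0 : Rabs (C0 * x0) <= 1 / 2).
    { rewrite Rabs_mult, (Rabs_pos_eq x0) by lra.
      apply Rle_trans with (W * x0); [|lra].
      apply Rmult_le_compat_r; [lra|]. apply Rle_trans with W3; [apply HW3|]; lra. }
    (* The expansion parameter is [x0 = 1 / z] at time 0, so [r0] is obtained by solving
       [/ r0 + C0 = / x0]. *)
    set (r0 := x0 * / (1 - C0 * x0)).
    destruct (inv_one_minus_bound _ HC0) as [Hi1 Hi2].
    assert (Hr0 : 0 < r0 <= 2 * x0).
    { unfold r0. split; [apply Rmult_lt_0_compat; lra|].
      rewrite Rmult_comm. apply Rmult_le_compat_r; lra. }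
    destruct (positive_solution_exists (P1 A B) P (S (S n)) W r0) as [r [Hri Hr]].
    - lia.
    - apply P1_continuous.
    - exact HP.
    - intros t Ht. apply Rle_trans with W2; auto.
    - intros t Ht. apply Rle_trans with W1; auto.
    - apply Hr0.
    - lra.
    - fold b. apply Rle_trans with (9 * (W * ((b + 3) * (4 * x0)))); [|lra].
      repeat apply Rmult_le_compat_l; lra.
    - apply (moment_series_bound A B W x0 P r n c K HP HWa); auto.
      + intros t Ht. split; [apply Rle_trans with W1 | apply Rle_trans with W3]; auto;
          [apply HW1 | apply HW3]; lra.
      + lra.
      + intros t Ht. destruct (Hr t Ht) as [H1 H2]. split; [exact H1 | lra].
      + rewrite Hri. fold C0. unfold r0.
        apply Rabs_le_between in HC0. field. split; lra.
      + apply Hc.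
        * intros t Ht. apply Hr, Ht.
        * rewrite Hri, Rabs_pos_eq; lra. }
  intros k Hk. specialize (Hcpos k).
  destruct (Rmult_integral _ _ (Hall k Hk)) as [H|H]; [lra | exact H].
Qed.

Theorem theorem2p3 (m : nat) (A B : R) (P2m : R -> R)
  (hm : (1 <= m)%nat)
  (hAB : A ^ 2 + B ^ 2 <> 0)
  (hP2m : homogeneous_trig_poly (2 * m) P2m) :
  center_at_zero
    (fun theta r => r * (P1 A B theta * r + P2m theta * r ^ (2 * m)))
  <->
  (forall j : nat, (j <= m)%nat ->
    RInt (fun theta => P1bar A B theta ^ (2 * j) * P2m theta) 0 (2 * PI) = 0).
Proof.
  split.
  - intros Hc j Hj. apply (moments_of_center m A B P2m hm); [|exact Hc | lia].
    (* In this direction the splitting serves to give the continuity of [P2m]. *)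
    destruct (homogeneous_splits A B _ P2m hAB hP2m) as [e [q Hs]].
    exact (even_odd_split_continuous _ _ _ _ _ _ Hs).
  - now apply center_of_moments.
Qed.
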